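(* Let $\alpha\in\mathbb{R}$ and let $\mathcal{F}$ be the family of sum-free subsets of $\mathbb{N}^*$. There exists $F_\alpha\in\mathcal{F}$ such that $$\sum_{f\in F_\alpha}f^{-\alpha}=\sup\Big\{\sum_{f\in F}f^{-\alpha} : F\in\mathcal{F}\Big\}.$$
   Context: A set $F\subset\mathbb{N}^*=\{1,2,\dots\}$ is sum-free if there are no $x,y,z\in F$ (not necessarily distinct) with $x+y=z$. Sums and suprema are taken in $[0,+\infty]$. *)

(* Defs.v *)
From mathcomp Require Import all_boot all_order all_algebra.
From mathcomp Require Import all_classical all_reals all_analysis.

Set Implicit Arguments.
Unset Strict Implicit.
Unset Printing Implicit Defensive.

Local Open Scope classical_set_scope.

Definition sum_free (F : set nat) : Prop :=
  F `<=` [set n | (0 < n)%N] /\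
  forall x y z : nat, F x -> F y -> F z -> (x + y)%N <> z.

(* [esum] is the supremum of the finite partial sums: the terms are
   nonnegative, and the value may be +oo. *)
Definition power_sum (R : realType) (alpha : R) (F : set nat) : \bar R :=
  (\esum_(f in F) ((f%:R `^ (- alpha))%:E))%R.

(* Main.v *)
(* If the sum over the odd numbers is infinite, the odd numbers are optimal.
   Otherwise the sum over all positive integers is finite, because every even
   term is dominated by a neighbouring odd term.  Then F |-> \sum_(f in F) f^-a
   is continuous for the product topology on subsets of N, and the sum-free sets
   form a closed subset of this compact space, so the supremum is attained.  The
   maximizer is obtained as the limit, along an ultrafilter, of almost optimal
   sets. *)
Require Import Defs.
From mathcomp Require Import all_boot all_order all_algebra.
From mathcomp Require Import all_classical all_reals all_analysis.
From mathcomp Require Import finmap zify lra.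

Import Order.TTheory GRing.Theory Num.Theory.

Local Open Scope classical_set_scope.

Section esum_sup.
Local Open Scope ring_scope.
Local Open Scope ereal_scope.

(** By injectivity, the sum of [a (f x)] over [D] is the sum of [a] over the image of [D], which is
    only a part of [E]. *)
Lemma le_esum_inj (R : realType) (T : choiceType) (a : T -> \bar R)
    (D E : set T) (f : T -> T) :
  (forall x, 0 <= a x) -> set_inj D f -> f @` D `<=` E ->
  (forall x, D x -> a x <= a (f x)) ->
  \esum_(x in D) a x <= \esum_(x in E) a x.
Proof.
move=> a0 finj fDE le_af; apply: (le_trans (le_esum le_af)).
rewrite -(esum_image D f a finj) [leRHS](esumID (f @` D))//.
by rewrite setIC (setIidl fDE) leeDl// esum_ge0.
Qed.

Lemma le_esum_subset (R : realType) (T : choiceType) (a : T -> \bar R)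
    (D E : set T) :
  (forall x, 0 <= a x) -> D `<=` E ->
  \esum_(x in D) a x <= \esum_(x in E) a x.
Proof.
by move=> a0 DE; apply: (@le_esum_inj R T a D E id) => //; rewrite image_id.
Qed.

(** Take [A] to be a finite subset whose partial sum comes within [e] of the total. The same [A]
    then bounds the tail of every subset of [D], which gives uniform control over a whole family. *)
Lemma esum_finite_tail (R : realType) (T : choiceType) (a : T -> \bar R)
    (D : set T) (e : R) :
  (forall x, 0 <= a x) -> \esum_(x in D) a x \is a fin_num -> (0 < e)%R ->
  exists2 A : set T, finite_set A & \esum_(x in D `&` ~` A) a x <= e%:E.
Proof.
move=> a0 Dfin e0.
have [_ [A [finA AD] <-] ltA] := ub_ereal_sup_adherent e0 Dfin.
exists A => //.
move: (ltA); rewrite -/(esum D a) -esum_fset//.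
have := Dfin; rewrite (esumID A)// (setIC D A) (setIidl AD).
set s := esum A a; set t := esum _ a.
rewrite fin_numD => /andP[sfin tfin].
rewrite -(fineK sfin) -(fineK tfin) -!EFinD lte_fin lee_fin; lra.
Qed.

(** An ultrafilter decides membership of each single point, and finitely many such decisions hold
    simultaneously on a set of [U]. *)
Lemma ultra_limit_finite (T : choiceType) (U : set_system (set T))
    (A : set T) : UltraFilter U -> finite_set A ->
  \forall E \near U, forall x, A x -> E x <-> U [set E' | E' x].
Proof.
move=> UU /finite_fsetP[X ->].
suff : U (\bigcap_(x in [set` X]) [set E | E x <-> U [set E' | E' x]]).
  by apply: filterS => E EX x xX; exact: EX.
apply: filter_bigI => x _.
have [Ux|nUx] := in_ultra_setVsetC [set E : set T | E x] UU.
  by apply: filterS (Ux) => E Ex; split.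
apply: filterS (nUx) => E nEx; split => [//|Ux].
by have [E' []] := filter_ex (filterI Ux nUx).
Qed.

(** The last hypothesis is closedness of [G] in the product topology on subsets of [T]: a set that
    members of [G] match on each finite window is in [G]. *)
Lemma esum_sup_attained (R : realType) (T : choiceType) (a : T -> \bar R)
    (D : set T) (G : set (set T)) :
  (forall x, 0 <= a x) -> \esum_(x in D) a x \is a fin_num ->
  G !=set0 -> (forall F, G F -> F `<=` D) ->
  (forall F, (forall A, finite_set A ->
     exists2 E, G E & forall x, A x -> E x <-> F x) -> G F) ->
  exists2 F, G F &
    \esum_(x in F) a x = ereal_sup [set \esum_(x in E) a x | E in G].
Proof.
move=> a0 Dfin [E0 GE0] GD Gclosed.
set M := ereal_sup _.
have le_M E : G E -> \esum_(x in E) a x <= M.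
  by move=> GE; apply: ereal_sup_ubound; exists E.
have Mfin : M \is a fin_num.
  rewrite ge0_fin_numE; last exact: le_trans (esum_ge0 _) (le_M _ GE0).
  apply: (@le_lt_trans _ _ (\esum_(x in D) a x)); last by rewrite ltey_eq Dfin.
  by apply: ge_ereal_sup => _ [E GE <-]; apply: le_esum_subset => //; exact: GD.
(* The almost optimal sets shrink with [e] and are nonempty because [M] is a finite supremum, so
   they form a filter base. *)
pose B (e : R) := [set E | G E /\ M - e%:E < \esum_(x in E) a x].
have FB : ProperFilter (filter_from [set e : R | (0 < e)%R] B).
  apply: filter_from_proper.
    apply: filter_from_filter; first by exists 1%R => /=.
    move=> e1 e2 /= e1_gt0 e2_gt0; exists (Num.min e1 e2).
      by rewrite /= lt_min e1_gt0.
    move=> E [GE ltE]; split; split => //; apply: le_lt_trans ltE;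
      by rewrite leeB// lee_fin ge_min lexx ?orbT.
  move=> e e0; have [_ [E GE <-] ltE] := ub_ereal_sup_adherent e0 Mfin.
  by exists E.
have [U [UU BU]] := ultraFilterLemma FB.
have UB e : (0 < e)%R -> U (B e) by move=> e0; apply: BU; exists e.
(* The limit of [U]: the points that lie in [U]-almost every set. *)
pose F := [set x | U [set E : set T | E x]].
have UF A : finite_set A -> U [set E | forall x, A x -> E x <-> F x].
  exact: ultra_limit_finite.
have GF : G F.
  apply: Gclosed => A finA.
  have [E [[GE _] EF]] := filter_ex (filterI (UB 1%R ltr01) (UF A finA)).
  by exists E.
exists F => //; apply/eqP; rewrite eq_le le_M//=.
(* One half of [e] pays for the near optimality of [E], the other for the part of [E] outside the
   window [A]; inside [A], [E] agrees with [F]. *)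
apply/lee_addgt0Pr => e e0; have e20 : (0 < e / 2)%R by rewrite divr_gt0.
have [A finA tailA] := esum_finite_tail _ _ _ _ _ a0 Dfin e20.
have [E [[GE ltE] EF]] := filter_ex (filterI (UB _ e20) (UF A finA)).
rewrite [e in e%:E]splitr EFinD addeA -leeBlDr//.
apply: (le_trans (ltW ltE)); rewrite (esumID A)//; apply: leeD.
  by apply: le_esum_subset => // x [Ex Ax]; apply/(EF x Ax).
apply: le_trans tailA; apply: le_esum_subset => //.
exact: setSI (GD _ GE).
Qed.

End esum_sup.

Lemma sum_free_odd : sum_free [set n | odd n].
Proof.
split=> [[]//|x y z /= ox oy + xyz].
by rewrite -xyz oddD ox oy.
Qed.

(** A violation involves at most three numbers, so it is already visible on a finite set. *)
Lemma sum_free_finite_character (F : set nat) :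
  (forall A, finite_set A ->
     exists2 E, sum_free E & forall x, A x -> E x <-> F x) -> sum_free F.
Proof.
move=> locF; split=> [n Fn|x y z Fx Fy Fz].
  have [E [E_gt0 _] EF] := locF [set n] (finite_set1 n).
  by apply: E_gt0; apply/(EF n).
have [|E [_ EE] EF] := locF [set x; y; z].
  by rewrite !finite_setU; do !split; exact: finite_set1.
by apply: EE; apply/EF => //=; tauto.
Qed.

(** The neighbour is chosen by monotonicity: [n - 1] when the terms decrease, [n + 1] when they
    increase. *)
Lemma power_sum_even_le_odd (R : realType) (alpha : R) :
  (power_sum alpha [set n | (0 < n)%N /\ ~~ odd n] <=
   power_sum alpha [set n | odd n])%E.
Proof.
have [alpha_ge0|alpha_lt0] := leP 0%R alpha.
- apply: (@le_esum_inj _ _ _ _ _ predn).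
  + by move=> n; rewrite lee_fin powR_ge0.
  + by move=> m n /set_mem[m0 _] /set_mem[n0 _]; lia.
  + by move=> _ [n [n0 nodd] <-] /=; lia.
  (* A positive even number is at least 2, so its predecessor is still positive and the inverses can
     be compared. *)
  + move=> [|[|n]] []// _ _; rewrite lee_fin !powRN lef_pV2 ?posrE ?powR_gt0//.
    by rewrite /= ge0_ler_powR ?nnegrE// ler_nat.
- apply: (@le_esum_inj _ _ _ _ _ S).
  + by move=> n; rewrite lee_fin powR_ge0.
  + by move=> m n _ _ [].
  + by move=> _ [n [n0 nodd] <-] /=.
  + move=> n _; rewrite lee_fin ge0_ler_powR ?nnegrE ?oppr_ge0 ?ler_nat//.
    exact: ltW.
Qed.

Theorem theorem6p2 (R : realType) (alpha : R) :
  exists Falpha : set nat, sum_free Falpha /\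
    power_sum alpha Falpha =
      ereal_sup [set power_sum alpha F | F in [set F : set nat | sum_free F]].
Proof.
have a0 n : (0 <= (n%:R `^ (- alpha))%R%:E :> \bar R)%E.
  by rewrite lee_fin powR_ge0.
have [odd_fin|odd_inf] := boolP (power_sum alpha [set n | odd n] \is a fin_num).
  have [||||F sfF supF] := @esum_sup_attained R nat _
    [set n | (0 < n)%N] sum_free a0; last by exists F.
  - rewrite (esumID [set n | odd n])// fin_numD; apply/andP; split.
      rewrite (_ : _ `&` _ = [set n | odd n])//.
      by apply/seteqP; split=> [n []//|[]].
    rewrite ge0_fin_numE ?esum_ge0//.
    apply: (@le_lt_trans _ _ (power_sum alpha [set n | odd n])).
      apply: le_trans (power_sum_even_le_odd _ _).
      by apply: le_esum_subset => // n [/= n0 /negP].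
    by rewrite ltey_eq odd_fin.
  - by exists [set n | odd n]; exact: sum_free_odd.
  - by move=> F [].
  - exact: sum_free_finite_character.
exists [set n | odd n]; split; first exact: sum_free_odd.
apply/eqP; rewrite eq_le; apply/andP; split.
  by apply: ereal_sup_ubound; exists [set n | odd n] => //; exact: sum_free_odd.
move: odd_inf; rewrite ge0_fin_numE ?esum_ge0// -leNgt leye_eq => /eqP ->.
exact: leey.
Qed.
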